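(* For every non-negative integer $L$, \[ \sum_{\substack{n,m\geq 0\\ L\equiv n+2m \ (\mathrm{mod}\ 3)}}\frac{(-1)^m q^{\frac{m(m-1)}{2}+Ln}(q;q)_L}{(q;q)_m(q;q)_n(q^3;q^3)_{(L-n-2m)/3}}=\sum_{j=-\infty}^{\infty}\left(\frac{j+1}{3}\right){2L\brack L-j}_q, \] and \[ \sum_{\substack{n,m\geq 0\\ L\equiv n+2m \ (\mathrm{mod}\ 3)}}\frac{(-1)^m q^{\frac{m(m+1)}{2}+(L+1)n}(q;q)_L}{(q;q)_m(q;q)_n(q^3;q^3)_{(L-n-2m)/3}}-\sum_{\substack{n,m\geq 0\\ L\equiv n+2m+1 \ (\mathrm{mod}\ 3)}}\frac{(-1)^m q^{\frac{m(m+1)}{2}+(L+1)n}(q;q)_L}{(q;q)_m(q;q)_n(q^3;q^3)_{(L-n-2m-1)/3}}=\sum_{j=-\infty}^{\infty}\left(\frac{j+1}{3}\right)q^{L-j}{2L\brack L-j}_q. \]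
   Context: $(a;p)_n=\prod_{k=0}^{n-1}(1-ap^k)$ for a base $p$. By convention $1/(q^3;q^3)_k=0$ for negative integers $k$, so only finitely many summands are nonzero. The $q$-binomial coefficient is ${m+n\brack m}_q=\frac{(q;q)_{m+n}}{(q;q)_m(q;q)_n}$ for $m,n\ge0$ and $0$ otherwise. $\left(\frac{a}{3}\right)$ denotes the Jacobi symbol modulo 3: $0$ if $3\mid a$, $1$ if $a\equiv1\pmod 3$, $-1$ if $a\equiv 2\pmod 3$. *)

(* Defs.v *)
From HB Require Import structures.
From mathcomp Require Export all_boot all_order all_algebra.
From mathcomp Require Export boolp classical_sets fsbigop.

Set Implicit Arguments.
Unset Strict Implicit.
Unset Printing Implicit Defensive.

Import GRing.Theory.

Local Open Scope ring_scope.

Definition qpoch (F : fieldType) (a p : F) (n : nat) : F :=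
  \prod_(k < n) (1 - a * p ^+ k).

(* 1 / (a; p)_k for an integer index k, which is 0 by convention when k < 0 *)
Definition inv_qpoch (F : fieldType) (a p : F) (k : int) : F :=
  match k with
  | Posz n => (qpoch a p n)^-1
  | Negz _ => 0
  end.

(* N is the upper entry m + n and k the lower entry m, so that n = N - k *)
Definition qbinom (F : fieldType) (q : F) (N k : int) : F :=
  if (0 <= k) && (0 <= N - k) then
    qpoch q q `|N|%N / (qpoch q q `|k|%N * qpoch q q `|N - k|%N)
  else 0.

Definition jacobi3 (a : int) : int :=
  if (3 %| a)%Z then 0 else if (a == 1 %[mod 3])%Z then 1 else -1.

(* Main.v *)
Require Import Defs.
From mathcomp Require Import functions ring zify.

(**
Let H_0 = H_1 = 1 and H_{N+1} = H_N - (1 - q^N) H_{N-1}; these are values of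
the continuous q-Hermite polynomials. Both sides of the first identity are
H_{2L} and both sides of the second one are H_{2L+1}.

On the right, S(N, a) = sum_k ((a-k)/3) [N, k]_q inherits the three-term
recurrence of the Rogers-Szego polynomials; the antisymmetry under
a -> N - a and the 3-periodicity of the Jacobi symbol give
S(2L, L+1) = H_{2L} and S(2L+1, L+1) = H_{2L+1}.

On the left, the sums are (q;q)_L [z^L] G_L and (q;q)_L [z^L] D_L, where
  G_L(z) = (z^2;q)_oo / ((z q^L;q)_oo (z^3;q^3)_oo),
  D_L(z) = (1-z) (q z^2;q)_oo / ((z q^(L+1);q)_oo (z^3;q^3)_oo).
Then G_{L+1}(z) = (1 - z q^L) G_L(z) = (1+z) D_L(z) and
(1 - q z^2) G_L(q z) = (1 + z + z^2) D_L(z), and comparing the coefficients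
of z^L and z^(L+1) yields the same recurrence.
*)

Set Implicit Arguments.
Unset Strict Implicit.
Unset Printing Implicit Defensive.

Import GRing.Theory.
Local Open Scope classical_set_scope.
Local Open Scope ring_scope.

(** * Finitely supported sums and q-Pochhammer symbols *)

Lemma fsbig_seq_cond (R : Type) (idx : R) (op : Monoid.com_law idx)
    (T : choiceType) (A : set T) (r : seq T) (f : T -> R) :
    uniq r -> (forall i, A i -> i \notin r -> f i = idx) ->
  \big[op/idx]_(i \in A) f i = \big[op/idx]_(i <- r | i \in A) f i.
Proof.
move=> r_uniq f_out; rewrite fsbig_mkcond (fsbigE r) //.
  rewrite big_mkcond [RHS]big_mkcond.
  by apply: eq_bigr => i _; rewrite in_setT.
by move=> i _ ir; rewrite /patch; case: ifPn => // /set_mem iA; apply: f_out.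
Qed.

Lemma qpochS (F : fieldType) (a p : F) (n : nat) :
  qpoch a p n.+1 = qpoch a p n * (1 - a * p ^+ n).
Proof. by rewrite /qpoch big_ord_recr. Qed.

Lemma qpoch0 (F : fieldType) (a p : F) : qpoch a p 0 = 1.
Proof. by rewrite /qpoch big_ord0. Qed.

Definition nonroot (F : fieldType) (q : F) :=
  forall k : nat, (0 < k)%N -> q ^+ k != 1.

Lemma nonrootX (F : fieldType) (q : F) (d : nat) :
  nonroot q -> (0 < d)%N -> nonroot (q ^+ d).
Proof. by move=> hq d0 k k0; rewrite -exprM hq // muln_gt0 d0. Qed.

Lemma nonroot_sub (F : fieldType) (q : F) (n : nat) :
  nonroot q -> 1 - q ^+ n.+1 != 0.
Proof. by move=> hq; rewrite subr_eq0 eq_sym hq. Qed.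

Lemma qpoch_neq0 (F : fieldType) (q : F) (n : nat) :
  nonroot q -> qpoch q q n != 0.
Proof.
move=> hq; apply/prodf_neq0 => i _.
by rewrite -exprS nonroot_sub.
Qed.

(** * Truncated power series as polynomials *)

Definition tsum (F : fieldType) (u : nat -> F) (Y : {poly F}) (N : nat) : {poly F} :=
  \sum_(i < N) (u i *: Y ^+ i : {poly F}).

Lemma tsumS (F : fieldType) (u : nat -> F) (Y : {poly F}) (N : nat) :
  tsum u Y N.+1 = tsum u Y N + u N *: Y ^+ N.
Proof. by rewrite /tsum big_ord_recr. Qed.

(** The coefficient recurrence expresses multiplication of the full series by 1 - c Y; truncation
    leaves only the product of the two top terms, which the last summand compensates. *)
Lemma tsum_mul1B (F : fieldType) (u v : nat -> F) (c : F) (Y : {poly F}) N :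
  v 0%N = u 0%N -> (forall n, v n.+1 = u n.+1 - c * u n) ->
  tsum v Y N.+1 = (1 - c *: Y) * tsum u Y N.+1 + (c * u N) *: Y ^+ N.+1.
Proof.
move=> v0 vS; elim: N => [|N IH].
  rewrite /tsum !big_ord1 !expr0 expr1 v0 -!mul_polyC polyCM; ring.
rewrite tsumS IH (tsumS u Y N.+1) vS -!mul_polyC polyCB !polyCM [Y ^+ N.+2]exprS; ring.
Qed.

Lemma tsum_compZ (F : fieldType) (u : nat -> F) (q : F) (d N : nat) :
  tsum u 'X^d N \Po (q *: 'X) = tsum (fun n => u n * q ^+ (d * n)) 'X^d N.
Proof.
rewrite /tsum raddf_sum /=; apply: eq_bigr => i _.
by rewrite comp_polyZ -exprM rmorphXn /= comp_polyX exprZn scalerA.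
Qed.

Lemma coef_compZ (F : fieldType) (p : {poly F}) (q : F) (n : nat) :
  (p \Po (q *: 'X))`_n = q ^+ n * p`_n.
Proof.
rewrite coef_comp_poly.
under eq_bigr => i _ do rewrite exprZn coefZ coefXn.
have [np|pn] := ltnP n (size p).
  rewrite (bigD1 (Ordinal np)) //= eqxx mulr1 big1 ?addr0 1?mulrC //.
  move=> i; rewrite -val_eqE /= eq_sym => /negbTE ->.
  by rewrite !mulr0.
rewrite [p`_n]nth_default // mulr0 big1 // => i _.
by rewrite gtn_eqF ?mulr0 // (leq_trans (ltn_ord i)).
Qed.

(* Coefficients of 1 / (z q^L; q)_oo in z, of (q^d z^2; q)_oo in z^2, and of
   1 / (z^3; q^3)_oo in z^3. *)
Definition ecoef (F : fieldType) (q : F) (L n : nat) : F :=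
  q ^+ (L * n) / qpoch q q n.
Definition bcoef (F : fieldType) (q : F) (d m : nat) : F :=
  (-1) ^+ m * q ^+ ('C(m, 2) + d * m) / qpoch q q m.
Definition ccoef (F : fieldType) (q : F) (k : nat) : F :=
  (qpoch (q ^+ 3) (q ^+ 3) k)^-1.

Lemma ecoefS (F : fieldType) (q : F) (L n : nat) : nonroot q ->
  ecoef q L.+1 n.+1 = ecoef q L n.+1 - q ^+ L * ecoef q L n.
Proof.
move=> hq; rewrite /ecoef qpochS -exprS.
have h1 := qpoch_neq0 n hq; have h2 := nonroot_sub n hq.
rewrite !mulnS !mulSn !exprD.
rewrite !exprS in h2 *.
by field; rewrite h1.
Qed.

Lemma bcoefS (F : fieldType) (q : F) (d m : nat) : nonroot q ->
  bcoef q d m.+1 = bcoef q d.+1 m.+1 - q ^+ d * bcoef q d.+1 m.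
Proof.
move=> hq; rewrite /bcoef qpochS -exprS.
have h1 := qpoch_neq0 m hq; have h2 := nonroot_sub m hq.
rewrite binS bin1 !mulnS !mulSn !exprD.
rewrite !exprS in h2 *.
by field; rewrite h1.
Qed.

(** Coefficient form of C(q z) = (1 - z^3) C(z) for C(z) = 1 / (z^3;q^3)_oo. The factor 1 is the [c]
    of [tsum_mul1B]. *)
Lemma ccoefS (F : fieldType) (q : F) (k : nat) : nonroot q ->
  ccoef q k.+1 * q ^+ (3 * k.+1) = ccoef q k.+1 - 1 * ccoef q k.
Proof.
move=> /nonrootX-/(_ 3%N isT) hq; rewrite /ccoef qpochS -exprS.
have h1 := qpoch_neq0 k hq; have h2 := nonroot_sub k hq.
rewrite exprM.
set x := _ ^+ k.+1 in h2 *.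
by field; rewrite h1.
Qed.

Definition Ese (F : fieldType) (q : F) (N L : nat) : {poly F} := tsum (ecoef q L) 'X^1 N.
Definition Bse (F : fieldType) (q : F) (N d : nat) : {poly F} := tsum (bcoef q d) 'X^2 N.
Definition Cse (F : fieldType) (q : F) (N : nat) : {poly F} := tsum (ccoef q) 'X^3 N.

(** From 1 / (z q^(L+1);q)_oo = (1 - z q^L) / (z q^L;q)_oo. Congruence modulo 'X^(N+1) is written
    with an explicit cofactor [r], so that it passes through products and disappears from
    coefficients of degree at most N. *)
Lemma EseS (F : fieldType) (q : F) (N L : nat) : nonroot q ->
  exists r : {poly F}, Ese q N.+1 L.+1 =
    (1 - q ^+ L *: 'X) * Ese q N.+1 L + r * 'X^(N.+1).
Proof.
move=> hq; exists (q ^+ L * ecoef q L N)%:P.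
rewrite /Ese (@tsum_mul1B _ (ecoef q L) _ (q ^+ L)).
- by rewrite mul_polyC expr1.
- by rewrite /ecoef !muln0.
- by move=> n; rewrite ecoefS.
Qed.

Lemma BseS (F : fieldType) (q : F) (N d : nat) : nonroot q ->
  exists r : {poly F}, Bse q N.+1 d =
    (1 - q ^+ d *: 'X^2) * Bse q N.+1 d.+1 + r * 'X^(N.+1).
Proof.
(* The truncation error lies in degree 2(N+1); one factor 'X^(N+1) is absorbed in the cofactor. *)
move=> hq; exists ((q ^+ d * bcoef q d.+1 N) *: 'X^(N.+1)).
rewrite /Bse (@tsum_mul1B _ (bcoef q d.+1) _ (q ^+ d)).
- by rewrite -exprM mul2n -addnn exprD -scalerAl.
- by rewrite /bcoef !muln0.
- by move=> n; rewrite bcoefS.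
Qed.

Lemma Cse_compZ (F : fieldType) (q : F) (N : nat) : nonroot q ->
  exists r : {poly F}, Cse q N.+1 \Po (q *: 'X) = (1 - 'X^3) * Cse q N.+1 + r * 'X^(N.+1).
Proof.
move=> hq; exists ((1 * ccoef q N) *: 'X^(N.+1 + N.+1)).
rewrite /Cse tsum_compZ (@tsum_mul1B _ (ccoef q) _ 1).
- by rewrite -exprM mulSn mul2n -addnn addnC exprD scale1r -scalerAl.
- by rewrite muln0 mulr1.
- by move=> n; rewrite ccoefS.
Qed.

Lemma Ese_compZ (F : fieldType) (q : F) (N L : nat) :
  Ese q N L \Po (q *: 'X) = Ese q N L.+1.
Proof.
rewrite /Ese tsum_compZ; apply: eq_bigr => i _.
by rewrite /ecoef mulrAC -exprD mul1n mulSn addnC.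
Qed.

Lemma Bse_compZ (F : fieldType) (q : F) (N d : nat) :
  Bse q N d \Po (q *: 'X) = Bse q N d.+2.
Proof.
rewrite /Bse tsum_compZ; apply: eq_bigr => i _.
rewrite /bcoef; congr (_ *: _); rewrite mulrAC; congr (_ / _).
by rewrite -mulrA -exprD; congr (_ * _ ^+ _); lia.
Qed.

(** * Functional equations of G_L and D_L, and the recurrence for their diagonal coefficients *)

Definition Gse (F : fieldType) (q : F) (N L : nat) : {poly F} :=
  Ese q N L * Bse q N 0 * Cse q N.
(** The factor 1 - 'X produces the subtracted sum of the second identity, whose congruence is
    shifted by one. *)
Definition Dse (F : fieldType) (q : F) (N L : nat) : {poly F} :=
  (1 - 'X) * (Ese q N L.+1 * Bse q N 1 * Cse q N).

Lemma GseS (F : fieldType) (q : F) (N L : nat) : nonroot q ->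
  exists r : {poly F}, Gse q N.+1 L.+1 = (1 - q ^+ L *: 'X) * Gse q N.+1 L + r * 'X^(N.+1).
Proof.
move=> hq; have [r rE] := EseS N L hq.
exists (r * Bse q N.+1 0 * Cse q N.+1); rewrite /Gse rE; ring.
Qed.

(** From (z^2;q)_oo = (1 - z)(1 + z)(q z^2;q)_oo. *)
Lemma mul1D_Dse (F : fieldType) (q : F) (N L : nat) : nonroot q ->
  exists r : {poly F}, Gse q N.+1 L.+1 = (1 + 'X) * Dse q N.+1 L + r * 'X^(N.+1).
Proof.
move=> hq; have [r rB] := BseS N 0 hq.
exists (Ese q N.+1 L.+1 * r * Cse q N.+1).
rewrite /Gse /Dse rB expr0 scale1r; ring.
Qed.

(** Substituting q z turns (z^2;q)_oo into (q^2 z^2;q)_oo, which 1 - q z^2 completes to (q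
    z^2;q)_oo, and it brings out 1 - z^3 = (1 - z)(1 + z + z^2), whose first factor belongs to
    D_L. *)
Lemma Gse_compZ (F : fieldType) (q : F) (N L : nat) : nonroot q ->
  exists r : {poly F}, (1 - q *: 'X^2) * (Gse q N.+1 L \Po (q *: 'X)) =
    (1 + 'X + 'X^2) * Dse q N.+1 L + r * 'X^(N.+1).
Proof.
move=> hq; have [r rB] := BseS N 1 hq; have [s sC] := Cse_compZ N hq.
rewrite expr1 in rB.
rewrite /Gse /Dse !comp_polyM Ese_compZ Bse_compZ sC.
set E := Ese _ _ _; set C := Cse _ _; set B2 := Bse _ _ 2.
set B1 := Bse _ _ 1 in rB *.
exists ((1 - q *: 'X^2) * B2 * E * s - E * r * C * (1 - 'X^3)).
have -> : B1 = (1 - q *: 'X^2) * B2 + r * 'X^(N.+1) by [].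
rewrite -!mul_polyC; ring.
Qed.

Lemma coefD_MXn (F : fieldType) (p r : {poly F}) (N n : nat) :
  (n < N)%N -> (p + r * 'X^N)`_n = p`_n.
Proof. by move=> nN; rewrite coefD coefMXn nN addr0. Qed.

Lemma coef_GseS (F : fieldType) (q : F) (N L : nat) :
  nonroot q -> (L < N)%N ->
  (1 - q ^+ L.+1) * (Gse q N.+1 L.+1)`_L.+1 =
  (Dse q N.+1 L)`_L - (1 - q ^+ (2 * L).+1) * (Gse q N.+1 L)`_L.
Proof.
move=> hq LN.
have [r1 e1] := GseS N L hq; have [r2 e2] := mul1D_Dse N L hq.
have [r3 e3] := Gse_compZ N L hq.
set G := Gse _ _ L in e1 e3 *; set D := Dse _ _ _ in e2 e3 *.
have a1 : (Gse q N.+1 L.+1)`_L.+1 = G`_L.+1 - q ^+ L * G`_L.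
  by rewrite e1 coefD_MXn // mulrBl mul1r -scalerAl coefB coefZ coefXM.
have a2 : (Gse q N.+1 L.+1)`_L.+1 = D`_L.+1 + D`_L.
  by rewrite e2 coefD_MXn // mulrDl mul1r coefD coefXM.
(* The coefficient of degree L-1 is written as that of 'X times the series in degree L, which is
   correctly 0 when L = 0. *)
have a3 : (Gse q N.+1 L.+1)`_L = G`_L - q ^+ L * ('X * G)`_L.
  by rewrite e1 coefD_MXn 1?ltnW // mulrBl mul1r -scalerAl coefB coefZ.
have a4 : (Gse q N.+1 L.+1)`_L = D`_L + ('X * D)`_L.
  by rewrite e2 coefD_MXn 1?ltnW // mulrDl mul1r coefD.
have a5 : q ^+ L.+1 * G`_L.+1 - q ^+ L * ('X * G)`_L
    = D`_L.+1 + D`_L + ('X * D)`_L.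
  have qG : q * ('X * (G \Po (q *: 'X)))`_L = q ^+ L * ('X * G)`_L.
    rewrite !coefXM; case: (L) => [|k] /=; first by rewrite !mulr0.
    by rewrite coef_compZ exprS mulrA.
  have := congr1 (fun p : {poly F} => p`_L.+1) e3.
  rewrite coefD_MXn // expr2 mulrBl !mulrDl !mul1r -scalerAl -!mulrA.
  by rewrite coefB coefZ coef_compZ !coefD ![('X * _)`_L.+1]coefXM /= qG.
have -> : q ^+ (2 * L).+1 = q ^+ L.+1 * q ^+ L by rewrite -exprD; congr (_ ^+ _); lia.
(* The two copies of the left coefficient are expanded differently, through D_L and through G_L;
   [a5], [a3] and [a4] then eliminate every coefficient off the diagonal. *)
rewrite mulrBl mul1r {1}a2 a1 mulrBr.
have -> : q ^+ L.+1 * G`_L.+1 =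
   q ^+ L * ('X * G)`_L + (D`_L.+1 + D`_L + ('X * D)`_L) by rewrite -a5; ring.
have -> : ('X * D)`_L = G`_L - q ^+ L * ('X * G)`_L - D`_L by rewrite -a3 a4; ring.
ring.
Qed.

(** Coefficient of z^(L+1) in D_{L+1} = (1 - q^(L+1) z) D_L, with the off-diagonal coefficient of
    D_L removed through G_{L+1} = (1 + z) D_L. *)
Lemma coef_DseS (F : fieldType) (q : F) (N L : nat) :
  nonroot q -> (L < N)%N ->
  (Dse q N.+1 L.+1)`_L.+1 =
  (Gse q N.+1 L.+1)`_L.+1 - (1 + q ^+ L.+1) * (Dse q N.+1 L)`_L.
Proof.
move=> hq LN.
have [r1 e1] := mul1D_Dse N L hq; have [r2 e2] := EseS N L.+1 hq.
have -> : Dse q N.+1 L.+1 = (1 - q ^+ L.+1 *: 'X) * Dse q N.+1 L +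
   (1 - 'X) * r2 * Bse q N.+1 1 * Cse q N.+1 * 'X^(N.+1).
  rewrite /Dse e2; ring.
rewrite e1 !coefD_MXn // mulrBl mulrDl !mul1r -scalerAl coefB coefD coefZ !coefXM /=.
ring.
Qed.

(** * The Jacobi symbol modulo 3 and q-binomial identities *)

Lemma jacobi3N (a : int) : jacobi3 (- a) = - jacobi3 a.
Proof. by rewrite /jacobi3; do !case: ifP; lia. Qed.

Lemma jacobi3_sum3 (a : int) :
  jacobi3 a + jacobi3 (a + 1) + jacobi3 (a + 2) = 0.
Proof. by rewrite /jacobi3; do !case: ifP; lia. Qed.

Lemma qbinom_nat (F : fieldType) (q : F) (N k : nat) : (k <= N)%N ->
  qbinom q N%:Z k%:Z = qpoch q q N / (qpoch q q k * qpoch q q (N - k)).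
Proof. by move=> kN; rewrite /qbinom subzn. Qed.

Lemma qbinom_out (F : fieldType) (q : F) (N k : nat) : (N < k)%N ->
  qbinom q N%:Z k%:Z = 0.
Proof. by move=> Nk; rewrite /qbinom ifF //; lia. Qed.

Lemma qbinom0r (F : fieldType) (q : F) (N : nat) : nonroot q ->
  qbinom q N%:Z 0%N%:Z = 1.
Proof.
by move=> hq; rewrite qbinom_nat // subn0 qpoch0 mul1r divff ?qpoch_neq0.
Qed.

Lemma qbinom_sym (F : fieldType) (q : F) (N k : nat) : (k <= N)%N ->
  qbinom q N%:Z (N - k)%N%:Z = qbinom q N%:Z k%:Z.
Proof.
by move=> kN; rewrite !qbinom_nat ?leq_subr // subKn // [X in _ / X]mulrC.
Qed.

Lemma qbinom_absorb (F : fieldType) (q : F) (N k : nat) : nonroot q ->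
  (1 - q ^+ k.+1) * qbinom q N.+1%:Z k.+1%:Z =
  (1 - q ^+ N.+1) * qbinom q N%:Z k%:Z.
Proof.
move=> hq; have [kN|Nk] := leqP k N; last by rewrite !qbinom_out ?mulr0.
rewrite !qbinom_nat // subSS !qpochS -!exprS.
have h1 := qpoch_neq0 k hq; have h2 := nonroot_sub k hq.
have h3 := qpoch_neq0 (N - k) hq.
by field; rewrite h1 h3.
Qed.

Lemma qbinom_pascal (F : fieldType) (q : F) (N k : nat) : nonroot q ->
  qbinom q N.+1%:Z k.+1%:Z =
  qbinom q N%:Z k%:Z + q ^+ k.+1 * qbinom q N%:Z k.+1%:Z.
Proof.
move=> hq; have [kN|Nk|->] := ltngtP k N; last 2 first.
- by rewrite !qbinom_out ?mulr0 ?addr0 //; lia.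
- rewrite (@qbinom_out _ _ N N.+1) // mulr0 addr0 !qbinom_nat // !subnn.
  by rewrite qpoch0 !mulr1 !divff ?qpoch_neq0.
rewrite !qbinom_nat // 1?ltnW // subSS.
have -> : (N - k = (N - k.+1).+1)%N by lia.
have h1 := qpoch_neq0 k hq; have h2 := nonroot_sub k hq.
have h3 := qpoch_neq0 (N - k.+1) hq; have h4 := nonroot_sub (N - k.+1) hq.
have eN : q ^+ N.+1 = q ^+ k.+1 * q ^+ (N - k.+1).+1.
  by rewrite -exprD; congr (_ ^+ _); lia.
rewrite !qpochS -!exprS eN.
set x := q ^+ k.+1 in h2 *; set y := q ^+ _ in h4 *.
by field; rewrite h1 h2 h3.
Qed.

(** Write q^(k+1) = 1 - (1 - q^(k+1)) in Pascal's rule and apply absorption. No coefficient depends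
    on k any more, so the recurrence can be summed over k. *)
Lemma qbinom_rec (F : fieldType) (q : F) (N k : nat) : nonroot q ->
  qbinom q N.+2%:Z k.+1%:Z =
  qbinom q N.+1%:Z k.+1%:Z + qbinom q N.+1%:Z k%:Z
  - (1 - q ^+ N.+1) * qbinom q N%:Z k%:Z.
Proof. by move=> hq; rewrite qbinom_pascal // -qbinom_absorb //; ring. Qed.

(** * The sums S(N, a) and their recurrences *)

Definition jsum (F : fieldType) (q : F) (N : nat) (a : int) : F :=
  \sum_(k < N.+1) (jacobi3 (a - k%:Z))%:~R * qbinom q N%:Z k%:Z.

Lemma jsum_widen (F : fieldType) (q : F) (N M : nat) (a : int) :
  (N < M)%N ->
  \sum_(k < M) (jacobi3 (a - k%:Z))%:~R * qbinom q N%:Z k%:Z = jsum q N a.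
Proof.
move=> NM; rewrite /jsum.
rewrite [RHS](big_ord_widen M
  (fun k => (jacobi3 (a - k%:Z))%:~R * qbinom q N%:Z k%:Z)) //.
rewrite [RHS]big_mkcond; apply: eq_bigr => i _.
by case: ltnP => // Ni; rewrite qbinom_out ?mulr0.
Qed.

Lemma jsum_rec (F : fieldType) (q : F) (N : nat) (a : int) : nonroot q ->
  jsum q N.+2 a =
  jsum q N.+1 a + jsum q N.+1 (a - 1) - (1 - q ^+ N.+1) * jsum q N (a - 1).
Proof.
(* Padding with zero terms makes all ranges agree once the k = 0 terms are split off. *)
move=> hq; rewrite -(@jsum_widen _ q N.+1 N.+3) // -(@jsum_widen _ q N N.+2) //.
rewrite [LHS]/jsum big_ord_recl [in RHS]big_ord_recl [jsum _ _ _]/jsum.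
rewrite !qbinom0r // -!addrA.
congr (_ + _); rewrite mulr_sumr -sumrB -big_split; apply: eq_bigr => i _ /=.
rewrite /bump /= !add1n qbinom_rec //.
have -> : a - 1 - i%:Z = a - i.+1%:Z by lia.
ring.
Qed.

Lemma jsum_sum3 (F : fieldType) (q : F) (N : nat) (a : int) :
  jsum q N a + jsum q N (a + 1) + jsum q N (a + 2) = 0.
Proof.
rewrite /jsum -!big_split big1 // => i _ /=.
rewrite -!mulrDl -!intrD (_ : _ + _ = 0) ?mul0r //.
by rewrite -(jacobi3_sum3 (a - i%:Z)); congr (_ + jacobi3 _ + jacobi3 _); lia.
Qed.

(** Reverse the summation by k -> N - k; the Jacobi symbol is odd. *)
Lemma jsum_sym (F : fieldType) (q : F) (N : nat) (a : int) :
  jsum q N (N%:Z - a) = - jsum q N a.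
Proof.
rewrite /jsum -sumrN (reindex_inj rev_ord_inj); apply: eq_bigr => i _ /=.
have iN : (i <= N)%N by rewrite -ltnS.
rewrite subSS qbinom_sym // -mulNr -rmorphN -jacobi3N /=.
by congr ((jacobi3 _)%:~R * _); lia.
Qed.

(* In characteristic 2 the antisymmetry alone does not force this to vanish. *)
Lemma jsum_mid (F : fieldType) (q : F) (L : nat) : nonroot q ->
  jsum q (2 * L) L%:Z = 0.
Proof.
move=> hq; elim: L => [|L IH].
  by rewrite /jsum big_ord1 mul0r.
rewrite mulnS jsum_rec //.
have -> : L.+1%:Z - 1 = L%:Z by lia.
have -> : jsum q (2 * L).+1 L.+1 = - jsum q (2 * L).+1 L.
  by rewrite -jsum_sym; congr jsum; lia.
by rewrite IH; ring.
Qed.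

(** The second term of [jsum_rec] is the central value that vanishes by [jsum_mid]. *)
Lemma jsum_odd (F : fieldType) (q : F) (L : nat) : nonroot q ->
  jsum q (2 * L.+1).+1 L.+2 =
  jsum q (2 * L.+1) L.+2 - (1 - q ^+ (2 * L.+1)) * jsum q (2 * L).+1 L.+1.
Proof.
move=> hq; rewrite [in LHS]mulnS jsum_rec //.
have -> : L.+2%:Z - 1 = L.+1%:Z by lia.
by rewrite -[(2 * L).+2]/(2 + 2 * L)%N -mulnS jsum_mid // addr0.
Qed.

(** Here S(2L+1, L+2) drops out: S(2L+1, L) and S(2L+1, L+1) cancel by antisymmetry, and three
    consecutive values sum to 0. *)
Lemma jsum_even (F : fieldType) (q : F) (L : nat) : nonroot q ->
  jsum q (2 * L.+1) L.+2 =
  jsum q (2 * L).+1 L.+1 - (1 - q ^+ (2 * L).+1) * jsum q (2 * L) L.+1.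
Proof.
move=> hq; rewrite mulnS jsum_rec //.
have -> : L.+2%:Z - 1 = L.+1%:Z by lia.
have := jsum_sum3 q (2 * L).+1 L%:Z.
have -> : jsum q (2 * L).+1 L%:Z = - jsum q (2 * L).+1 L.+1%:Z.
  by rewrite -jsum_sym; congr jsum; lia.
have -> : L%:Z + 1 = L.+1%:Z by lia.
have -> : L%:Z + 2 = L.+2%:Z by lia.
by rewrite addNr add0r => ->; ring.
Qed.

(** * Matching the two recurrences *)

Lemma coef_tsum0 (F : fieldType) (u : nat -> F) (d N : nat) :
  (tsum u 'X^(d.+1) N.+1)`_0 = u 0%N.
Proof.
rewrite /tsum big_ord_recl coefD coefZ coef1 mulr1 coef_sum big1 ?addr0 //.
by move=> i _; rewrite coefZ -exprM coefXn mulr0.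
Qed.

(** Simultaneous induction on L at a fixed truncation order N. The new factor 1 - q^(L+1) of
    [qpoch q q L.+1] is the one on the left of [coef_GseS]. *)
Lemma coef_jsum (F : fieldType) (q : F) (N L : nat) : nonroot q -> (L <= N)%N ->
  qpoch q q L * (Gse q N.+1 L)`_L = jsum q (2 * L) L.+1 /\
  qpoch q q L * (Dse q N.+1 L)`_L = jsum q (2 * L).+1 L.+1.
Proof.
move=> hq; elim: L => [_|L IH LN].
  rewrite qpoch0 !mul1r /Gse /Dse mulrBl mul1r coefB coefXM /= subr0 !coef0M.
  rewrite /Ese /Bse /Cse !coef_tsum0 /ecoef /bcoef /ccoef !qpoch0 /jsum.
  rewrite !big_ord_recr !big_ord0 /= !qbinom0r //.
  by rewrite !muln0 !expr0 !add0r invr1 !mulr1 mul0r addr0.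
have [IHG IHD] := IH (ltnW LN).
have eG : qpoch q q L.+1 * (Gse q N.+1 L.+1)`_L.+1 = jsum q (2 * L.+1) L.+2.
  by rewrite qpochS -exprS -mulrA coef_GseS // jsum_even // -IHG -IHD; ring.
split=> //; rewrite coef_DseS // jsum_odd // -eG -IHD qpochS -exprS.
have -> : q ^+ (2 * L.+1) = q ^+ L.+1 * q ^+ L.+1.
  by rewrite -exprD; congr (_ ^+ _); lia.
ring.
Qed.

(** * From the sums of the theorem to coefficients and finite sums *)

Lemma inv_qpoch_lt0 (F : fieldType) (a p : F) (k : int) :
  (k < 0)%R -> inv_qpoch a p k = 0.
Proof. by case: k. Qed.

(** For given i and j, at most one k satisfies L = s + i + 2j + 3k; it exists exactly when the
    congruence holds and the quotient by 3 is nonnegative. The shift s is 0 or 1 in the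
    application. *)
Lemma fsbig_coef_tsum (F : fieldType) (q : F) (e b : nat -> F) (L s N : nat) :
  (L < N)%N ->
  \sum_(x \in [set x : nat * nat | L = x.1 + 2 * x.2 + s %[mod 3]])
     (e x.1 * b x.2 * inv_qpoch (q ^+ 3) (q ^+ 3)
        ((L%:Z - x.1%:Z - 2 * x.2%:Z - s%:Z) %/ 3)%Z) =
  ('X^s * (tsum e 'X^1 N * tsum b 'X^2 N * tsum (ccoef q) 'X^3 N))`_L.
Proof.
move=> LN.
rewrite (@fsbig_seq_cond _ _ _ _ _
  [seq (i, j) | i <- index_iota 0 N, j <- index_iota 0 N]); first last.
- move=> [i j] _ /= /allpairsPdep ij.
  rewrite inv_qpoch_lt0 ?mulr0 //.
  (* Outside the square, i + 2j + s exceeds L, so the index of [inv_qpoch] is negative. *)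
  suff : (N <= i)%N \/ (N <= j)%N by lia.
  have [iN|] := ltnP i N; last by left.
  have [jN|] := ltnP j N; last by right.
  by case: ij; exists i, j; rewrite !mem_index_iota iN jN.
- by rewrite allpairs_uniq ?iota_uniq // => -[? ?] [? ?].
rewrite big_mkcond big_allpairs_dep big_mkord /=.
(* The third series is kept opaque while the first two are expanded. *)
have [C CE] : exists C, C = tsum (ccoef q) 'X^3 N by eexists.
rewrite -CE /tsum mulr_suml mulr_suml mulr_sumr coef_sum; apply: eq_bigr => i _.
rewrite big_mkord mulr_sumr mulr_suml mulr_sumr coef_sum; apply: eq_bigr => j _.
rewrite CE /tsum mulr_sumr mulr_sumr coef_sum.
have coefE (k : 'I_N) : ('X^s * (e i *: 'X^1 ^+ i * (b j *: 'X^2 ^+ j) *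
      (ccoef q k *: 'X^3 ^+ k)))`_L =
    e i * b j * ccoef q k * (L == s + i + 2 * j + 3 * k)%N%:R.
  rewrite -coefXn -coefCM; congr (polyseq _)`_L.
  by rewrite -!mul_polyC -!exprM !polyCM mul1n !exprD; ring.
under [RHS]eq_bigr => k _ do rewrite coefE.
case: ifPn => [/set_mem /= Aij | /negP Aij]; last first.
  rewrite big1 // => k _; case: eqP => [Lk|]; last by rewrite mulr0.
  by case: Aij; apply/mem_set => /=; lia.
have [Lij|ijL] := ltnP L (s + i + 2 * j).
  rewrite inv_qpoch_lt0 ?mulr0; last by lia.
  rewrite big1 // => k _; case: eqP => [Lk|]; [lia | by rewrite mulr0].
have kN : ((L - (s + i + 2 * j)) %/ 3 < N)%N by lia.
rewrite (bigD1 (Ordinal kN)) //= big1 => [|k]; last first.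
  rewrite -val_eqE /= => /eqP kk; case: eqP => [Lk|]; [lia | by rewrite mulr0].
rewrite addr0 (_ : (L == _) = true) ?mulr1; last by apply/eqP; lia.
congr (_ * _); rewrite /ccoef.
by have -> : (((L%:Z - i%:Z - 2 * j%:Z - s%:Z) %/ 3)%Z
   = Posz ((L - (s + i + 2 * j)) %/ 3)) by lia.
Qed.

(** Substitute k = L - j; the q-binomial vanishes for k outside 0..2L. The weight [f] is 1 for the
    first identity and a power of q for the second. *)
Lemma fsbig_jacobi3_qbinom (F : fieldType) (q : F) (L : nat) (f : int -> F) :
  \sum_(j \in [set: int])
    ((jacobi3 (j + 1))%:~R * f (L%:Z - j) * qbinom q (2 * L%:Z) (L%:Z - j)) =
  \sum_(k < (2 * L).+1)
    (jacobi3 (L.+1%:Z - k%:Z))%:~R * f k%:Z * qbinom q (2 * L)%N%:Z k%:Z.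
Proof.
rewrite (@fsbig_seq_cond _ _ _ _ _
  [seq L%:Z - k%:Z | k <- index_iota 0 (2 * L).+1]); first last.
- move=> j _ /mapP jL; rewrite /qbinom ifF ?mulr0 //; apply/negP => /andP[j0 j1].
  case: jL; exists `|L%:Z - j|%N; last by lia.
  by rewrite mem_index_iota; lia.
- by rewrite map_inj_uniq ?iota_uniq // => i j; lia.
rewrite big_map big_mkord; apply: eq_big => [k|k _]; first by rewrite in_setT.
have -> : L%:Z - (L%:Z - k%:Z) = k%:Z by lia.
have -> : 2 * L%:Z = (2 * L)%N%:Z by lia.
by congr ((jacobi3 _)%:~R * _ * _); lia.
Qed.

(* Pascal's rule trades [q ^ k] for an extra sum that vanishes by antisymmetry. *)
Lemma jsum_weighted (F : fieldType) (q : F) (L : nat) : nonroot q ->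
  \sum_(k < (2 * L).+1)
    (jacobi3 (L.+1%:Z - k%:Z))%:~R * q ^+ k * qbinom q (2 * L)%N%:Z k%:Z =
  jsum q (2 * L).+1 L.+1.
Proof.
move=> hq.
have := jsum_mid L hq; rewrite -(@jsum_widen _ q _ (2 * L).+1) // => mid0.
rewrite /jsum [RHS]big_ord_recl [LHS]big_ord_recl expr0 mulr1 !qbinom0r //.
congr (_ + _).
rewrite -[LHS]add0r -{1}mid0 [X in _ + X = _](_ : _ = \sum_(k < (2 * L).+1)
  (jacobi3 (L%:Z - k%:Z))%:~R * q ^+ k.+1 * qbinom q (2 * L)%N%:Z k.+1%:Z).
  rewrite -big_split; apply: eq_bigr => k _ /=; rewrite /bump /= !add1n.
  rewrite qbinom_pascal // (_ : L.+1%:Z - k.+1%:Z = L%:Z - k%:Z); last by lia.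
  ring.
rewrite [RHS]big_ord_recr /= (qbinom_out _ (ltnSn _)) mulr0 addr0.
apply: eq_bigr => k _; rewrite /bump /= !add1n.
by congr ((jacobi3 _)%:~R * _ * _); lia.
Qed.

Theorem theorem29 (F : fieldType) (q : F)
    (hq : forall k : nat, (0 < k)%N -> q ^+ k != 1) (L : nat) :
  (\sum_(x \in [set x : nat * nat | L = x.1 + 2 * x.2 %[mod 3]])
     (let: (n, m) := x in
      (-1) ^+ m * q ^+ ((m * (m - 1)) %/ 2 + L * n)%N * qpoch q q L
        / (qpoch q q m * qpoch q q n)
        * inv_qpoch (q ^+ 3) (q ^+ 3)
            ((L%:Z - n%:Z - 2 * m%:Z) %/ 3)%Z)
   = \sum_(j \in [set: int])
       ((jacobi3 (j + 1))%:~R * qbinom q (2 * L%:Z) (L%:Z - j)))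
  /\
  (\sum_(x \in [set x : nat * nat | L = x.1 + 2 * x.2 %[mod 3]])
     (let: (n, m) := x in
      (-1) ^+ m * q ^+ ((m * (m + 1)) %/ 2 + (L + 1) * n)%N * qpoch q q L
        / (qpoch q q m * qpoch q q n)
        * inv_qpoch (q ^+ 3) (q ^+ 3)
            ((L%:Z - n%:Z - 2 * m%:Z) %/ 3)%Z)
   - \sum_(x \in [set x : nat * nat | L = x.1 + 2 * x.2 + 1 %[mod 3]])
     (let: (n, m) := x in
      (-1) ^+ m * q ^+ ((m * (m + 1)) %/ 2 + (L + 1) * n)%N * qpoch q q L
        / (qpoch q q m * qpoch q q n)
        * inv_qpoch (q ^+ 3) (q ^+ 3)
            ((L%:Z - n%:Z - 2 * m%:Z - 1) %/ 3)%Z)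
   = \sum_(j \in [set: int])
       ((jacobi3 (j + 1))%:~R * q ^ (L%:Z - j)
          * qbinom q (2 * L%:Z) (L%:Z - j))).
Proof.
have [GE DE] := coef_jsum hq (leqnn L).
have tri m : ((m * (m - 1)) %/ 2 = 'C(m, 2) + 0 * m)%N.
  by rewrite bin2 subn1 divn2 mul0n addn0.
have triS m : ((m * (m + 1)) %/ 2 = 'C(m, 2) + 1 * m)%N.
  by have := bin2 m.+1; rewrite binS bin1 divn2 mulnC addn1 mul1n /= => ->.
have termE d M n m :
    (-1) ^+ m * q ^+ ('C(m, 2) + d * m + M * n)%N * qpoch q q L
      / (qpoch q q m * qpoch q q n) = qpoch q q L * ecoef q M n * bcoef q d m.
  have h1 := qpoch_neq0 m hq; have h2 := qpoch_neq0 n hq.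
  by rewrite /ecoef /bcoef exprD; field; rewrite h1.
have set0E : [set x : nat * nat | L = x.1 + 2 * x.2 %[mod 3]] =
    [set x : nat * nat | L = x.1 + 2 * x.2 + 0 %[mod 3]].
  by apply/seteqP; split=> x /=; rewrite addn0.
have sumE d M s :
  \sum_(x \in [set x : nat * nat | L = x.1 + 2 * x.2 + s %[mod 3]])
    (let: (n, m) := x in qpoch q q L * ecoef q M n * bcoef q d m
       * inv_qpoch (q ^+ 3) (q ^+ 3)
           ((L%:Z - n%:Z - 2 * m%:Z - s%:Z) %/ 3)%Z) =
  qpoch q q L * ('X^s * (Ese q L.+1 M * Bse q L.+1 d * Cse q L.+1))`_L.
  rewrite [X in _ * X](_ : _ = ('X^s * (tsum (ecoef q M) 'X^1 L.+1 *
    tsum (bcoef q d) 'X^2 L.+1 * tsum (ccoef q) 'X^3 L.+1))`_L) //.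
  rewrite -coefZ scalerAr !scalerAl.
  have -> : qpoch q q L *: tsum (ecoef q M) 'X^1 L.+1 =
      tsum (fun n => qpoch q q L * ecoef q M n) 'X^1 L.+1.
    by rewrite /tsum scaler_sumr; apply: eq_bigr => i _; rewrite scalerA.
  by rewrite -fsbig_coef_tsum //; apply: eq_fsbigr => -[n m].
rewrite set0E; split.
  transitivity (qpoch q q L * (Gse q L.+1 L)`_L).
    have := sumE 0%N L 0%N; rewrite expr0 mul1r => <-.
    by apply: eq_fsbigr => -[n m] _; rewrite tri termE subr0.
  rewrite GE /jsum.
  transitivity (\sum_(j \in [set: int])
    ((jacobi3 (j + 1))%:~R * 1 * qbinom q (2 * L%:Z) (L%:Z - j))).
    rewrite (@fsbig_jacobi3_qbinom _ _ _ (fun=> 1)).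
    by apply: eq_bigr => k _; rewrite mulr1.
  by apply: eq_fsbigr => j _; rewrite mulr1.
transitivity (qpoch q q L * (Dse q L.+1 L)`_L).
  (* Distributing 1 - 'X gives the two sums on the left, with shifts 0 and 1. *)
  rewrite /Dse mulrBl mul1r coefB mulrBr.
  have := sumE 1%N L.+1 0%N; rewrite expr0 mul1r => <-.
  have := sumE 1%N L.+1 1%N; rewrite expr1 => <-.
  congr (_ - _); apply: eq_fsbigr => -[n m] _.
    by rewrite triS addn1 termE subr0.
  by rewrite triS addn1 termE.
by rewrite DE (@fsbig_jacobi3_qbinom _ _ _ (fun j => q ^ j)) -jsum_weighted.
Qed.
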